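(* Let $H\in(0,1)$, $T>0$, $\mathbb{T}=[0,T]$, and let $(A_\ell,\ell\in\mathbb{N}_0)$, $A_\ell\ge0$, be an angular power spectrum decaying algebraically with order $\alpha>2$, i.e. there exist $C>0$ and $\ell_0\in\mathbb{N}$ with $A_\ell\le C\ell^{-\alpha}$ for all $\ell>\ell_0$. Let $$B_Q^H(t)=\sum_{\ell=0}^\infty\sum_{m=-\ell}^{\ell}\sqrt{A_\ell}\,\beta^H_{\ell,m}(t)\,Y_{\ell,m},\qquad B_Q^{H,\kappa}(t)=\sum_{\ell=0}^\kappa\sum_{m=-\ell}^{\ell}\sqrt{A_\ell}\,\beta^H_{\ell,m}(t)\,Y_{\ell,m},\quad \kappa\in\mathbb{N}.$$ Then $(B_Q^{H,\kappa},\kappa\in\mathbb{N})$ converges to $B_Q^H$ in $L^p(\Omega;L^2(\mathbb{S}^2))$ for every finite $p\ge1$, uniformly in $t\in\mathbb{T}$, with $$\sup_{t\in\mathbb{T}}\|B_Q^H(t)-B_Q^{H,\kappa}(t)\|_{L^p(\Omega;L^2(\mathbb{S}^2))}\le \hat C_p\,T^H\,\kappa^{-(\alpha-2)/2}$$ for all $\kappa\ge\ell_0$, where $\hat C_p$ depends only on $p$, $C$ and $\alpha$. Moreover, the convergence holds $\mathbb{P}$-almost surely: for every $t\in\mathbb{T}$ and every $\beta<(\alpha-2)/2$ there exists a random variable $\kappa_0(t)$ such that for all $\kappa>\kappa_0(t)$, $$\|B_Q^H(t)-B_Q^{H,\kappa}(t)\|_{L^2(\mathbb{S}^2)}\le\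kappa^{-\beta}\quad\mathbb{P}\text{-a.s.}$$
   Context: $\mathbb{S}^2$ is the unit sphere in $\mathbb{R}^3$; $(Y_{\ell,m},\ \ell\in\mathbb{N}_0,\ m=-\ell,\dots,\ell)$ are the real-valued spherical harmonics, an orthonormal basis of $L^2(\mathbb{S}^2)$; $(\beta^H_{\ell,m})$ are independent real-valued fractional Brownian motions with Hurst parameter $H$ (continuous centered Gaussian processes with covariance $\frac12(t^{2H}+s^{2H}-|t-s|^{2H})$). $B_Q^H$ is the isotropic $Q$-fractional Brownian motion on $\mathbb{S}^2$ with covariance operator $QY_{\ell,m}=A_\ell Y_{\ell,m}$, and the series defining it converges in $L^2(\Omega;L^2(\mathbb{S}^2))$. *)

(* Defs.v *)
From HB Require Import structures.
From mathcomp Require Import all_boot all_order all_algebra.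
From mathcomp Require Import all_classical all_reals all_analysis.
Set Implicit Arguments. Unset Strict Implicit. Unset Printing Implicit Defensive.
Import Order.TTheory GRing.Theory Num.Def Num.Theory.
Import numFieldTopology.Exports.
Local Open Scope classical_set_scope.
Local Open Scope ring_scope.

Section defs.
Context {R : realType}.

Definition pt := ((R * R) * R)%type.
Definition x1 (y : pt) : R := y.1.1.
Definition x2 (y : pt) : R := y.1.2.
Definition x3 (y : pt) : R := y.2.
Definition enorm (y : pt) : R := Num.sqrt (x1 y ^+ 2 + x2 y ^+ 2 + x3 y ^+ 2).
Definition normalize (y : pt) : pt :=
  ((x1 y / enorm y, x2 y / enorm y), x3 y / enorm y).

Definition lebesgue3 : set pt -> \bar R :=
  ((@lebesgue_measure R \x @lebesgue_measure R) \x @lebesgue_measure R)%E.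

Definition pball : set pt := [set y | 0 < enorm y <= 1].

(** Integral over the unit sphere S^2 w.r.t. the surface measure, via the
    cone measure: int_{S^2} f dsigma = 3 int_{0<|y|<=1} f(y/|y|) dy. *)
Definition sph_int (f : pt -> \bar R) : \bar R :=
  (3%:E * \int[lebesgue3]_(y in pball) f (normalize y))%E.

Definition sph_norm2 (g : pt -> R) : \bar R := sph_int (fun x => (g x ^+ 2)%:E).
Definition sph_norm (g : pt -> R) : \bar R := poweR (sph_norm2 g) (2^-1).

(** Real spherical harmonics.  cs m x = Re((x1 + i x2)^m), sn m = Im(...). *)
Fixpoint cssn (m : nat) (y : pt) : R * R :=
  match m with
  | 0 => (1, 0)
  | m'.+1 => let: (c, s) := cssn m' y in
             (x1 y * c - x2 y * s, x1 y * s + x2 y * c)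
  end.

(** m-th derivative of the Legendre polynomial P_l (Rodrigues formula). *)
Definition legendre_deriv (l m : nat) : {poly R} :=
  ((2 ^+ l * (l`!)%:R)^-1) *: (((('X ^+ 2 - 1) ^+ l) : {poly R})^`(l + m)).

Definition sh_const (l m : nat) : R :=
  Num.sqrt ((2 * l%:R + 1) / (4 * pi) * (l - m)`!%:R / (l + m)`!%:R).

(** Y_{l,m}, m integer with |m| <= l (defined arbitrarily otherwise). *)
Definition Ylm (l : nat) (m : int) (y : pt) : R :=
  match m with
  | Posz 0 => sh_const l 0 * (legendre_deriv l 0).[x3 y]
  | Posz k => Num.sqrt 2 * sh_const l k * (legendre_deriv l k).[x3 y] * (cssn k y).1
  | Negz k => Num.sqrt 2 * sh_const l k.+1 * (legendre_deriv l k.+1).[x3 y]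
                * (cssn k.+1 y).2
  end.

Definition trunc_field {Omega : Type} (A : nat -> R)
  (beta : nat -> int -> R -> Omega -> R) (kappa : nat) (t : R) (w : Omega) : pt -> R :=
  fun y => \sum_(l < kappa.+1) \sum_(i < (2 * l).+1)
    Num.sqrt (A l) * beta l (i%:Z - l%:Z) t w * Ylm l (i%:Z - l%:Z) y.

Definition fbm_cov (H t s : R) : R :=
  (t `^ (2 * H) + s `^ (2 * H) - `|t - s| `^ (2 * H)) / 2.

Context {d : measure_display} {Omega : measurableType d}.

Definition centered_gaussian (P : probability Omega R) (Z : Omega -> R) (v : R) :=
  measurable_fun setT Z /\
  forall B : set R, measurable B ->
    P (Z @^-1` B) = if v == 0 then \d_(0 : R) B else normal_prob 0 (Num.sqrt v) B.

Definition gaussian_family (P : probability Omega R) (I : Type) (valid : I -> Prop)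
  (X : I -> Omega -> R) (K : I -> I -> R) :=
  forall (n : nat) (idx : 'I_n -> I) (c : 'I_n -> R),
    (forall k, valid (idx k)) ->
    centered_gaussian P (fun w => \sum_(k < n) c k * X (idx k) w)
      (\sum_(k < n) \sum_(j < n) c k * c j * K (idx k) (idx j)).

Definition indep_fbm_family (P : probability Omega R) (H : R)
  (beta : nat -> int -> R -> Omega -> R) :=
  gaussian_family P
    (fun i : nat * int * R => (`|i.1.2| <= i.1.1)%N /\ 0 <= i.2)
    (fun i => beta i.1.1 i.1.2 i.2)
    (fun i j => if i.1 == j.1 then fbm_cov H i.2 j.2 else 0)
  /\ (forall l m w, {within [set t : R | 0 <= t], continuous (fun t => beta l m t w)}).

End defs.

(* Main.v *)
Require Import Defs.
From HB Require Import structures.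
From mathcomp Require Import all_boot all_order all_algebra.
From mathcomp Require Import all_classical all_reals all_analysis.
From mathcomp Require Import measurable_realfun ring lra zify.
Import Order.TTheory GRing.Theory Num.Def Num.Theory.
Import numFieldTopology.Exports.
Local Open Scope classical_set_scope.
Local Open Scope ring_scope.

(** For fixed [y] on the sphere, the increment of the truncated series from level
    [kappa] to level [kappa + n] is a centered Gaussian variable.  By Unsoeld's identity
    [\sum_m Y_{l,m}(y)^2 = (2l+1)/(4 pi)] its variance does not depend on [y], and it is
    at most [T^{2H}] times the tail [\sum_{l > kappa} A_l (2l+1)/(4 pi)], which is of order
    [kappa^{-(alpha-2)}].  Hence the even moments of the increments on the product of
    [Omega] and the sphere are bounded uniformly in [n], without any use of the
    orthogonality of the [Y_{l,m}].  These bounds survive the limit [n -> oo], where only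
    convergence in [L^2] is known, by truncating [Z^2] at a level [M] and then letting [M]
    grow.  Hoelder's inequality on the sphere turns them into moment bounds for the
    [L^2]-norm of the error, from which the [L^p] rate follows; Chebyshev's inequality
    with a sufficiently high moment and the Borel-Cantelli lemma give the almost sure rate. *)

(** * Unsoeld's identity *)

(** By Leibniz' rule only the term in which all [l] derivatives fall on the power survives at the
    root. The induction takes one derivative and absorbs the remainder into a new cofactor [q]. *)
Lemma derivn_root_pow (R : comNzRingType) (a : R) (l : nat) (q : {poly R}) :
  ((('X - a%:P) ^+ l * q)^`(l)).[a] = l`!%:R * q.[a].
Proof.
elim: l q => [|l IH] q; first by rewrite expr0 mul1r derivn0 fact0 mul1r.
rewrite derivSn.
have -> : (('X - a%:P) ^+ l.+1 * q)^`() =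
    ('X - a%:P) ^+ l * (l.+1%:R *: q + ('X - a%:P) * q^`()).
  rewrite derivM deriv_exp derivB derivX derivC subr0 mul1r /= exprS.
  by rewrite scaler_nat mulrDr mulrnAl mulrnAr [_ ^+ l * (_ * _)]mulrCA mulrA.
rewrite IH hornerD hornerM hornerXsubC subrr mul0r addr0 hornerZ mulrA -natrM.
by rewrite factS mulnC.
Qed.

Section Legendre.
Context {R : realType}.
Implicit Types (l k : nat).

(** The power [v] satisfies the first-order equation [(X^2 - 1) v' = 2 l X v]. Differentiating it
    once gives the case [n = 0], and every further derivative is one induction step. *)
Lemma rodrigues_ode l (n : nat) :
  let v := ('X ^+ 2 - 1) ^+ l : {poly R} in
  ('X ^+ 2 - 1) * v^`(n.+2) + (n.+1%:R * 2 - l%:R * 2) *: ('X * v^`(n.+1))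
   + (n.+1%:R * (n%:R - l%:R * 2)) *: v^`(n) = 0.
Proof.
move=> v.
have dq : ('X ^+ 2 - 1 : {poly R})^`() = 2%:R *: 'X.
  by rewrite derivB derivXn derivC subr0 expr1 scaler_nat.
have base : ('X ^+ 2 - 1) * v^`() = (2 * l%:R) *: ('X * v).
  rewrite /v; case: (l) => [|l']; first by rewrite expr0 derivC mulr0 mulr0 scale0r.
  rewrite deriv_exp dq /= [_ ^+ l'.+1]exprS -mulr_natl -!mul_polyC !rmorphM/= !rmorph_nat.
  ring.
elim: n => [|n IH].
  have := congr1 (@deriv R) base.
  rewrite derivM dq derivZ derivM derivX mul1r (derivnS _ 1) !derivn1 derivn0.
  move/eqP; rewrite addrC -subr_eq0 => /eqP <-.
  rewrite -!mul_polyC ?(polyCM, polyCB, polyCD, polyCMn, polyC1); ring.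
have := congr1 (@deriv R) IH.
rewrite deriv0 !derivD !derivZ !derivM dq derivX mul1r -!derivnS => <-.
rewrite -!mul_polyC ?(polyCM, polyCB, polyCD, polyCMn, polyC1); ring.
Qed.

Lemma legendre_derivS l k : (legendre_deriv l k)^`() = legendre_deriv l k.+1 :> {poly R}.
Proof. by rewrite /legendre_deriv derivZ -derivnS addnS. Qed.

Lemma legendre_deriv_gt l : legendre_deriv l l.+1 = 0 :> {poly R}.
Proof.
rewrite /legendre_deriv derivn_poly0 ?scaler0// addnS addnn.
rewrite (leq_trans (size_poly_exp_leq _ _))//.
by rewrite -[1]/(1%:P) size_XnsubC//= mulnC muln2.
Qed.

(** The case [n = l + k] of [rodrigues_ode], rescaled by the Rodrigues factor. *)
Lemma legendre_ode l k :
  ('X ^+ 2 - 1) * legendre_deriv l k.+2 + (2 * k.+1%:R) *: ('X * legendre_deriv l k.+1)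
   - ((l%:R - k%:R) * (l%:R + k%:R + 1)) *: legendre_deriv l k = 0 :> {poly R}.
Proof.
have := rodrigues_ode l (l + k).
move=> /(congr1 (fun x => (2 ^+ l * (l`!)%:R)^-1 *: x)).
rewrite scaler0 => <-; rewrite /legendre_deriv !addnS.
rewrite -!mul_polyC ?(polyCM, polyCB, polyCD, polyCMn, polyC1); ring.
Qed.

(** Factoring [X^2 - 1 = (X - 1)(X + 1)] and applying [derivn_root_pow] at the root 1 gives
    [l! 2^l], which the Rodrigues factor cancels. *)
Lemma legendre1 l : (legendre_deriv l 0).[1] = 1 :> R.
Proof.
rewrite /legendre_deriv addn0 hornerZ subr_sqr_1 exprMn.
have -> : ('X - 1 : {poly R}) = 'X - 1%:P by [].
rewrite derivn_root_pow horner_exp !hornerE -[1 + 1]/(2%:R).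
by rewrite /= -mulrA [_%:R * _]mulrC mulVf// mulf_neq0 ?expf_neq0// pnatr_eq0 -?lt0n ?fact_gt0.
Qed.

(** The part of [sh_const l k ^+ 2] that depends on the order [k]; the other factor,
    [(2l+1)/(4 pi)], is common to all orders. *)
Definition fact_ratio l k : R := (l - k)`!%:R / (l + k)`!%:R.

(** The extra factor is the zeroth-order coefficient of [legendre_ode]; this match makes the sum
    over the orders telescope. *)
Lemma fact_ratioS l k : (k < l)%N ->
  fact_ratio l k = fact_ratio l k.+1 * ((l%:R - k%:R) * (l%:R + k%:R + 1)).
Proof.
move=> kl; rewrite /fact_ratio addnS factS.
have -> : (l - k)`! = ((l - k) * (l - k.+1)`!)%N by rewrite -subnSK// factS.
rewrite !natrM natrB 1?ltnW// -natr1 natrD.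
have ? : (l + k)`!%:R != 0 :> R by rewrite pnatr_eq0 -lt0n fact_gt0.
have ? : l%:R + k%:R + 1 != 0 :> R by rewrite -natrD natr1 pnatr_eq0.
by field; apply/andP.
Qed.

(* By the Legendre equation each summand has derivative [T_(k+1) - T_k], where
   [T_k = fact_ratio l k * (1 - X^2)^k * P^(k) * P^(k+1)]. *)
Lemma deriv_unsold_sum l j : (j <= l)%N ->
  (\sum_(k < j) fact_ratio l k.+1 *:
      ((1 - 'X ^+ 2) ^+ k.+1 * legendre_deriv l k.+1 ^+ 2))^`() =
  fact_ratio l j *: ((1 - 'X ^+ 2) ^+ j * (legendre_deriv l j * legendre_deriv l j.+1))
  - legendre_deriv l 0 * legendre_deriv l 1 :> {poly R}.
Proof.
elim: j => [_|j IH jl].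
  by rewrite big_ord0 deriv0 expr0 mul1r /fact_ratio subn0 addn0 divff ?scale1r ?subrr//.
rewrite big_ord_recr/= derivD IH 1?ltnW// derivZ derivM deriv_exp expr2 derivM.
rewrite derivB derivC sub0r derivM derivX legendre_derivS (fact_ratioS _ _ jl).
have := legendre_ode l j.
set a := legendre_deriv l j; set b := legendre_deriv l j.+1.
set c := legendre_deriv l j.+2; move: (fact_ratio l j.+1) => e ode.
apply/eqP; rewrite -subr_eq0; apply/eqP.
(* The difference of the two sides is a multiple of the left-hand side of the Legendre equation; the
   [0] marks the place where [ode] is substituted. *)
transitivity (- e *: ((1 - 'X ^+ 2) ^+ j * b * 0) : {poly R});
  last by rewrite mulr0 scaler0.
rewrite -ode -!mul_polyC ?(polyCM, polyCB, polyCD, polyCMn, polyC1, polyCN) [_ ^+ j.+1]exprS /=.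
ring.
Qed.

(** The left-hand side has zero derivative, by [deriv_unsold_sum] at [j = l] where the boundary term
    contains [P^(l+1) = 0]. It is therefore constant, and at 1 only [P_l(1)^2 = 1] remains. The
    factor 2 accounts for the orders [k] and [-k]. *)
Lemma legendre_unsold l :
  legendre_deriv l 0 ^+ 2 + 2%:R *: \sum_(k < l) fact_ratio l k.+1 *:
    ((1 - 'X ^+ 2) ^+ k.+1 * legendre_deriv l k.+1 ^+ 2) = 1 :> {poly R}.
Proof.
set F := (X in X = _).
have F0 : F^`() = 0.
  rewrite /F derivD derivZ deriv_unsold_sum// legendre_deriv_gt mulr0 mulr0 scaler0.
  rewrite expr2 derivM legendre_derivS -mul_polyC polyCMn. ring.
have FC : F = (F`_0)%:P.
  apply/polyP => -[|i]; rewrite coefC//=.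
  have /eqP := congr1 (fun p : {poly R} => p`_i) F0.
  by rewrite coef_deriv coef0 mulrn_eq0 => /eqP.
have : F.[1] = 1.
  rewrite hornerD horner_exp legendre1 expr1n hornerZ horner_sum big1 ?mulr0 ?addr0//.
  move=> k _; rewrite hornerZ hornerM horner_exp hornerD hornerN hornerC hornerXn.
  by rewrite expr1n subrr expr0n mul0r mulr0.
by rewrite {1}FC hornerC => F1; rewrite FC F1.
Qed.

Lemma cssn_norm m (y : @pt R) :
  (cssn m y).1 ^+ 2 + (cssn m y).2 ^+ 2 = (x1 y ^+ 2 + x2 y ^+ 2) ^+ m.
Proof.
elim: m => [|m IH] /=; first by rewrite expr1n expr0n addr0.
by case: cssn IH => c s /= IH; rewrite [RHS]exprS -IH; ring.
Qed.

(* Unsoeld's identity, the diagonal case of the addition theorem. *)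
Lemma sum_Ylm_sqr l (y : @pt R) : x1 y ^+ 2 + x2 y ^+ 2 + x3 y ^+ 2 = 1 ->
  \sum_(i < (2 * l).+1) Ylm l (i%:Z - l%:Z) y ^+ 2 = (2 * l%:R + 1) / (4 * pi).
Proof.
move=> y1.
have pi0 : 0 < 4 * pi :> R by rewrite mulr_gt0// pi_gt0.
have shE k : sh_const l k ^+ 2 = (2 * l%:R + 1) / (4 * pi) * fact_ratio l k :> R.
  by rewrite /sh_const -mulrA sqr_sqrtr// mulr_ge0 ?divr_ge0 ?ler0n// ?(ltW pi0)//.
(* Index [i = l] is order 0, larger indices are the positive orders, and smaller ones, read
   backwards, are the negative orders. *)
have split_sum : \sum_(i < (2 * l).+1) Ylm l (i%:Z - l%:Z) y ^+ 2 =
    Ylm l 0 y ^+ 2 + \sum_(k < l) (Ylm l k.+1%:Z y ^+ 2 + Ylm l (- k.+1%:Z) y ^+ 2).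
  rewrite (_ : (2 * l).+1 = l + l.+1)%N; last by rewrite addnS mul2n addnn.
  rewrite big_split_ord/= big_ord_recl big_split/= addn0 subrr.
  rewrite addrCA; congr (_ + _); rewrite addrC; congr (_ + _).
    apply: eq_bigr => k _.
    by rewrite (_ : (l + bump 0 k)%:Z - l%:Z = k.+1%:Z)// /bump/= add1n; lia.
  rewrite (reindex_inj rev_ord_inj)/=; apply: eq_bigr => k _.
  by rewrite (_ : (l - k.+1)%N%:Z - l%:Z = - k.+1%:Z)//; have := ltn_ord k; lia.
rewrite split_sum /Ylm -/(cssn _ y) exprMn shE.
under eq_bigr => k _.
  have -> : - k.+1%:Z = Negz k by [].
  rewrite !exprMn sqr_sqrtr// shE -mulrDr cssn_norm; over.
have /(congr1 (horner^~ (x3 y))) := legendre_unsold l.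
rewrite hornerD hornerZ horner_sum horner_exp hornerC => unsold.
set c := (2 * l%:R + 1) / (4 * pi).
rewrite -[RHS]mulr1 -[X in _ = _ * X]unsold mulrDr [X in _ = _ + X]mulrA mulr_sumr; congr (_ + _).
  by rewrite /fact_ratio subn0 addn0 divff ?mulr1// pnatr_eq0 -lt0n fact_gt0.
apply: eq_bigr => k _. move: (legendre_deriv l k.+1) => u.
rewrite hornerZ hornerM !horner_exp hornerD hornerN hornerC hornerXn.
have -> : x1 y ^+ 2 + x2 y ^+ 2 = 1 - x3 y ^+ 2 by rewrite -y1 addrK.
ring.
Qed.
End Legendre.

(** * Gaussian moments *)

Section normal_moments.
Context {R : realType}.
Local Notation mu := (@lebesgue_measure R).

(** The change of variables is first made with the Radon-Nikodym derivative. It agrees almost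
    everywhere with [normal_pdf], since both have the same integral over every measurable set. *)
Lemma ge0_integral_normal_prob (m s : R) (f : R -> \bar R) :
  measurable_fun setT f -> (forall x, 0 <= f x)%E ->
  (\int[normal_prob m s]_x f x = \int[mu]_x (f x * (normal_pdf m s x)%:E))%E.
Proof.
move=> mf f0; have dom := normal_prob_dominates m s.
rewrite -(Radon_Nikodym_SigmaFinite.change_of_variables dom f0 measurableT mf).
have mpdf : measurable_fun [set: R] (fun x => (normal_pdf m s x)%:E).
  by apply/measurable_EFinP; exact: measurable_normal_pdf.
have iRN := Radon_Nikodym_SigmaFinite.f_integrable dom.
apply: ae_eq_integral => //.
- by apply: emeasurable_funM => //; exact: measurable_int iRN.
- exact: emeasurable_funM.
apply: ae_eqe_mul2l; apply: integral_ae_eq => // E _ mE.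
by rewrite -(Radon_Nikodym_SigmaFinite.f_integral dom).
Qed.

(** The quotient [y^n / n!] is a single term of the exponential series. *)
Lemma exprn_le_fact_expR (y : R) n : 0 <= y -> y ^+ n <= n`!%:R * expR y.
Proof.
move=> y0; case: n => [|n].
  by rewrite expr0 mul1r -expR0 ler_expR.
rewrite mulrC -ler_pdivrMr ?ltr0n ?fact_gt0//.
by apply: le_trans (expR_ge1Dxn n y0); rewrite lerDr.
Qed.

(** Since [x^(2q) <= 4^q q! exp(x^2/4)], the integrand is at most a constant times [exp(-x^2/4)],
    the shape of the normal density of variance 2. The ratio of the peaks in [K] adjusts the
    normalisation. *)
Lemma normal_moment_lty q :
  (\int[@normal_prob R 0 1]_x (x ^+ (2 * q))%:E < +oo)%E.
Proof.
have me : measurable_fun [set: R] (fun x => (x ^+ (2 * q))%:E).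
  by apply/measurable_EFinP; exact: exprn_measurable.
have x0 (x : R) : 0 <= x ^+ (2 * q) by rewrite exprM exprn_ge0// sqr_ge0.
have s2 : Num.sqrt 2 != 0 :> R by rewrite gt_eqF// sqrtr_gt0.
pose K : R := 4 ^+ q * q`!%:R * normal_peak 1 / normal_peak (Num.sqrt 2).
rewrite ge0_integral_normal_prob//.
have peak0 (s : R) : s != 0 -> 0 < normal_peak s := @normal_peak_gt0 R s.
have K0 : 0 <= K by rewrite !mulr_ge0 ?exprn_ge0 ?invr_ge0// ltW// peak0.
apply: (@le_lt_trans _ _ (\int[mu]_x (K%:E * (normal_pdf 0 (Num.sqrt 2) x)%:E)))%E.
  apply: ge0_le_integral => //.
  - by move=> x _; rewrite mule_ge0// lee_fin ?normal_pdf_ge0.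
  - apply: emeasurable_funM => //.
    by apply/measurable_EFinP; exact: measurable_normal_pdf.
  - apply: emeasurable_funM => //.
    by apply/measurable_EFinP; exact: measurable_normal_pdf.
  move=> x _; rewrite -!EFinM lee_fin !normal_pdfE ?oner_eq0// /normal_fun !subr0.
  rewrite sqr_sqrtr// expr1n /K.
  rewrite [leRHS](_ : _ = 4 ^+ q * q`!%:R * normal_peak 1 * expR (- x ^+ 2 / (2 *+ 2))); last first.
    by field; rewrite gt_eqF// peak0.
  rewrite [leRHS](_ : _ = 4 ^+ q * (q`!%:R * expR (x ^+ 2 / 4)) *
      (normal_peak 1 * expR (- x ^+ 2 / (1 *+ 2)))); last first.
    have -> : - x ^+ 2 / (2 *+ 2) = x ^+ 2 / 4 + - x ^+ 2 / (1 *+ 2) by field.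
    by rewrite expRD; ring.
  rewrite ler_wpM2r//; first by rewrite mulr_ge0 ?expR_ge0// ltW// peak0// oner_eq0.
  rewrite exprM -[in leLHS](divfK (_ : (4 : R) != 0) (x ^+ 2))// exprMn mulrC.
  by rewrite ler_wpM2l ?exprn_ge0// exprn_le_fact_expR// divr_ge0 ?sqr_ge0.
rewrite ge0_integralZl//.
- by rewrite integral_normal_pdf mule1 ltry.
- by apply/measurable_EFinP; exact: measurable_normal_pdf.
- by move=> x _; rewrite lee_fin normal_pdf_ge0.
Qed.

Context {d : measure_display} {Omega : measurableType d} (P : probability Omega R).

(** Dividing the coefficients by [Num.sqrt v] gives a standard normal variable, and [v ^+ q] comes
    out by homogeneity. For [v = 0] the law is the Dirac mass at 0, and [0 < q] makes both sides
    vanish. *)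
Lemma gaussian_family_moment (I : Type) (valid : I -> Prop) (X : I -> Omega -> R)
    (K : I -> I -> R) n (idx : 'I_n -> I) (c : 'I_n -> R) (q : nat) v :
  gaussian_family P valid X K -> (forall k, valid (idx k)) -> (0 < q)%N ->
  v = \sum_(k < n) \sum_(j < n) c k * c j * K (idx k) (idx j) -> 0 <= v ->
  (\int[P]_w ((\sum_(k < n) c k * X (idx k) w) ^+ (2 * q))%:E =
   (v ^+ q)%:E * \int[@normal_prob R 0 1]_x (x ^+ (2 * q))%:E)%E.
Proof.
move=> GF vidx q0 vE v0.
have me : measurable_fun [set: R] (fun x => (x ^+ (2 * q))%:E).
  by apply/measurable_EFinP; exact: exprn_measurable.
have x0 (x : R) : 0 <= x ^+ (2 * q) by rewrite exprM exprn_ge0// sqr_ge0.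
have law (Z : Omega -> R) (nu : probability (measurableTypeR R) R) : measurable_fun setT Z ->
    (forall B, measurable B -> P (Z @^-1` B) = nu B) ->
    (\int[P]_w (Z w ^+ (2 * q))%:E = \int[nu]_x (x ^+ (2 * q))%:E)%E.
  move=> mZ PZ.
  have mZ' : @measurable_fun _ _ Omega (measurableTypeR R) setT Z by exact: mZ.
  pose Z' : {mfun Omega >-> measurableTypeR R} :=
    @mfun_Sub _ _ Omega (measurableTypeR R) Z (mem_set mZ').
  rewrite -[LHS](@ge0_integral_distribution _ _ _ _ _ P Z' (fun x => (x ^+ (2 * q))%:E))//.
  by apply: eq_measure_integral => A mA _; exact: PZ.
have [v_eq0|vn0] := eqVneq v 0.
  have [mZ PZ] := GF n idx c vidx.
  rewrite -vE v_eq0 eqxx in PZ.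
  rewrite (law _ [the probability _ _ of @dirac _ (measurableTypeR R) 0 R] mZ PZ).
  rewrite v_eq0 expr0n -[q == 0]negbK -lt0n q0 mul0e.
  by rewrite integral_dirac// expr0n muln_eq0/= -[q == 0]negbK -lt0n q0 mule0.
have vp : 0 < v by rewrite lt_neqAle eq_sym vn0.
have sv0 : Num.sqrt v != 0 by rewrite gt_eqF// sqrtr_gt0.
have [mZ PZ] := GF n idx (fun k => c k / Num.sqrt v) vidx.
have v1 : \sum_(k < n) \sum_(j < n)
    c k / Num.sqrt v * (c j / Num.sqrt v) * K (idx k) (idx j) = 1.
  transitivity (v / v); last by rewrite divff.
  rewrite [X in _ = X / _]vE mulr_suml; apply: eq_bigr => k _.
  rewrite mulr_suml; apply: eq_bigr => j _.
  by rewrite -[in RHS](sqr_sqrtr v0); field.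
rewrite v1 oner_eq0 sqrtr1 in PZ.
rewrite -(law _ [the probability _ _ of normal_prob 0 1] mZ PZ) -ge0_integralZl//.
- apply: eq_integral => w _; rewrite -EFinM; congr EFin.
  rewrite (_ : v ^+ q = Num.sqrt v ^+ (2 * q)); last by rewrite exprM sqr_sqrtr.
  rewrite -exprMn mulr_sumr.
  by congr (_ ^+ _); apply: eq_bigr => k _; field.
- by apply: (measurableT_comp me).
- by move=> w _; rewrite lee_fin.
- by rewrite lee_fin exprn_ge0.
Qed.

End normal_moments.

(** * Transfer of moments to an L^2 limit *)

Section moment_transfer.
Context {R : realType} {d : measure_display} {T : measurableType d}.
Variable mu : {measure set T -> \bar R}.

Lemma ler_expn (n : nat) (a b : R) : 0 <= a -> a <= b -> a ^+ n <= b ^+ n.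
Proof. by move=> a0 ab; apply: lerXn2r; rewrite ?nnegrE// (le_trans a0). Qed.

(* Either [|y| >= |x - y|], so that [|x| <= 2|y|], or [|x| <= 2|x - y|]. *)
Lemma truncated_pow_le (x y M : R) q : 0 <= M ->
  Num.min (x ^+ 2) M ^+ q.+1 <=
  4 ^+ q.+1 * (y ^+ (2 * q.+1) + M ^+ q * (x - y) ^+ 2).
Proof.
move=> M0; set m := Num.min _ _.
have m0 : 0 <= m by rewrite le_min sqr_ge0.
have mx : m <= x ^+ 2 by rewrite ge_min lexx.
have mM : m <= M by rewrite ge_min lexx orbT.
have y0 : 0 <= y ^+ (2 * q.+1) by rewrite exprM exprn_ge0// sqr_ge0.
have r0 : 0 <= M ^+ q * (x - y) ^+ 2 by rewrite mulr_ge0 ?sqr_ge0 ?exprn_ge0.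
have [h|h] := leP ((x - y) ^+ 2) (y ^+ 2).
  apply: (@le_trans _ _ (4 ^+ q.+1 * y ^+ (2 * q.+1))).
    rewrite exprM -exprMn; apply: ler_expn => //.
    by apply: le_trans mx _; nra.
  by rewrite ler_wpM2l ?exprn_ge0// lerDl.
apply: (@le_trans _ _ (4 ^+ q.+1 * (M ^+ q * (x - y) ^+ 2))); last first.
  by rewrite ler_wpM2l ?exprn_ge0// lerDr.
apply: (@le_trans _ _ (4 * (M ^+ q * (x - y) ^+ 2))).
  rewrite exprSr mulrCA ler_pM ?exprn_ge0 ?ler_expn//.
  by apply: le_trans mx _; nra.
rewrite ler_wpM2r// exprS ler_peMr// exprn_ege1//. lra.
Qed.

(** For a fixed truncation level [M], [truncated_pow_le] bounds the truncated moment by the moment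
    of [G N] plus [M^q] times the squared distance, which vanishes as [N] grows. Monotone
    convergence then removes [M]. *)
Lemma moment_transfer (Z : T -> R) (G : nat -> T -> R) (q : nat) (K : \bar R) :
  measurable_fun setT Z -> (forall N, measurable_fun setT (G N)) ->
  (forall N, \int[mu]_x (G N x ^+ (2 * q.+1))%:E <= K)%E ->
  (fun N => \int[mu]_x ((Z x - G N x) ^+ 2)%:E)%E @ \oo --> 0%E ->
  (\int[mu]_x (Z x ^+ (2 * q.+1))%:E <= (4 ^+ q.+1)%:E * K)%E.
Proof.
move=> mZ mG GK ZG.
have even_ge0 (x : R) : 0 <= x ^+ (2 * q.+1) by rewrite exprM exprn_ge0// sqr_ge0.
have c0 : 0 <= 4 ^+ q.+1 :> R by rewrite exprn_ge0.
pose f (M : nat) x : \bar R := (Num.min (Z x ^+ 2) M%:R ^+ q.+1)%:E.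
have mf M : measurable_fun setT (f M).
  apply/measurable_EFinP; apply: measurable_funX.
  by apply: measurable_minr => //; exact: measurable_funX.
have f0 M x : (0 <= f M x)%E by rewrite lee_fin exprn_ge0// le_min sqr_ge0/=.
have trunc_bound M : (\int[mu]_x f M x <= (4 ^+ q.+1)%:E * K)%E.
  have step N : (\int[mu]_x f M x <= (4 ^+ q.+1)%:E *
      (K + (M%:R ^+ q)%:E * \int[mu]_x ((Z x - G N x) ^+ 2)%:E))%E.
    have m1 : measurable_fun setT (fun x => (G N x ^+ (2 * q.+1))%:E).
      by apply/measurable_EFinP; exact: measurable_funX.
    have m2 : measurable_fun setT (fun x => ((Z x - G N x) ^+ 2)%:E).
      by apply/measurable_EFinP; apply: measurable_funX; exact: measurable_funB.
    have m2M : measurable_fun setT (fun x => (M%:R ^+ q)%:E * ((Z x - G N x) ^+ 2)%:E)%E.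
      exact: emeasurable_funM.
    apply: (@le_trans _ _ (\int[mu]_x ((4 ^+ q.+1)%:E * ((G N x ^+ (2 * q.+1))%:E +
        (M%:R ^+ q)%:E * ((Z x - G N x) ^+ 2)%:E)))%E).
      apply: ge0_le_integral => //.
      + by apply: emeasurable_funM => //; exact: emeasurable_funD.
      + by move=> x _; rewrite lee_fin; exact: truncated_pow_le.
    have p2 x : (0 <= ((Z x - G N x) ^+ 2)%:E)%E by rewrite lee_fin sqr_ge0.
    have Mq : (0 <= (M%:R ^+ q)%:E :> \bar R)%E by rewrite lee_fin exprn_ge0.
    rewrite ge0_integralZl//; last 2 first.
      + exact: emeasurable_funD.
      + by move=> x _; apply: adde_ge0; [rewrite lee_fin|exact: mule_ge0].
    rewrite ge0_integralD//; last 2 first.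
      + by move=> x _; rewrite lee_fin.
      + by move=> x _; rewrite mule_ge0.
    by rewrite ge0_integralZl// lee_wpmul2l ?lee_fin// leeD2r.
  have cv : (fun N => (4 ^+ q.+1)%:E *
      (K + (M%:R ^+ q)%:E * \int[mu]_x ((Z x - G N x) ^+ 2)%:E))%E @ \oo -->
      ((4 ^+ q.+1)%:E * (K + (M%:R ^+ q)%:E * 0))%E.
    apply: cvgeZl => //; apply: cvgeD.
    - by rewrite mule0 fin_num_adde_defl.
    - exact: cvg_cst.
    - by apply: cvgeZl.
  rewrite mule0 adde0 in cv.
  by apply: (cvge_to_ge cv); apply: nearW.
have nd_f x : {homo f ^~ x : n m / (n <= m)%N >-> (n <= m)%E}.
  move=> n m nm; rewrite lee_fin ler_expn// ?le_min ?sqr_ge0 ?ler0n//=.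
  by rewrite !ge_min lexx/= ler_nat nm orbT.
have lim_f x : f ^~ x @ \oo --> (Z x ^+ (2 * q.+1))%:E.
  (* As soon as [M] exceeds [Z x ^+ 2] the minimum is inactive, so the sequence is eventually
     constant. *)
  apply: cvg_near_cst; exists (truncn (Z x ^+ 2)).+1 => // M /= ZM.
  rewrite /f min_l -?exprM//; apply: ltW.
  by apply: (lt_le_trans (truncnS_gt _)); rewrite ler_nat.
have -> : (\int[mu]_x (Z x ^+ (2 * q.+1))%:E = \int[mu]_x (limn (f ^~ x)))%E.
  by apply: eq_integral => x _; apply/esym/cvg_lim => //; exact: lim_f.
rewrite monotone_convergence//.
apply: lime_le; last exact: nearW.
apply: ereal_nondecreasing_is_cvgn => n m nm.
by apply: ge0_le_integral => // x _; exact: nd_f.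
Qed.

(* Hoelder's inequality against the indicator of the support of [f]. *)
Lemma pow_integral_sqr_le (D : set T) (f : T -> R) (q : nat) :
  measurable D -> measurable_fun setT f -> (forall x, ~ D x -> f x = 0) ->
  ((\int[mu]_x (f x ^+ 2)%:E) `^ q.+2%:R <=
   mu D `^ q.+1%:R * \int[mu]_x (f x ^+ (2 * q.+2))%:E)%E.
Proof.
move=> mD mf f0.
set r : R := q.+2%:R.
have r0 : 0 < r by rewrite ltr0n.
(* The exponent conjugate to [r = q + 2]: raising to the power [r] turns [mu D] to the power [1/r']
   into the integer power [q + 1]. *)
pose r' : R := r / q.+1%:R.
have q1 : (0 : R) < q.+1%:R by rewrite ltr0n.
have r'0 : 0 < r' by rewrite divr_gt0.
have rr' : r^-1 + r'^-1 = 1.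
  by rewrite /r' invf_div -[X in X + _]mul1r -mulrDl nat1r divff// gt_eqF.
have mf2 : measurable_fun setT (fun x => f x ^+ 2) by exact: measurable_funX.
have m1 : measurable_fun setT (\1_D : T -> R) by exact: measurable_indic.
have := hoelder mu mf2 m1 r0 r'0 rr'.
rewrite [X in (X <= _)%E](_ : _ = \int[mu]_x (f x ^+ 2)%:E)%E; last first.
  rewrite Lnorm1; apply: eq_integral => x _ /=.
  rewrite indicE; have [xD|xD] := boolP (x \in D); first by rewrite mulr1 ger0_norm ?sqr_ge0.
  by rewrite mulr0 normr0 f0 ?expr0n// => /mem_set; apply/negP.
have -> : ('N[mu]_r%:E[EFin \o (fun x => (f x ^+ 2)%R)] =
    (\int[mu]_x (f x ^+ (2 * q.+2))%:E) `^ r^-1)%E.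
  rewrite unlock; congr (_ `^ _)%E; apply: eq_integral => x _ /=.
  by rewrite ger0_norm ?sqr_ge0// powR_mulrn ?sqr_ge0// exprM.
have -> : ('N[mu]_r'%:E[EFin \o \1_D] = mu D `^ r'^-1)%E.
  rewrite unlock; congr (_ `^ _)%E.
  rewrite -[in RHS](setIT D) -integral_indic//; apply: eq_integral => x _ /=.
  rewrite indicE; case: (x \in D); first by rewrite normr1 powR1.
  by rewrite normr0 powR0// gt_eqF.
move=> H; have := gt0_ler_poweR (ltW r0).
move=> /(_ _ _ _ _ H); rewrite poweRM ?poweR_ge0// -!poweRrM.
rewrite (mulVf (lt0r_neq0 r0)) poweRe1; last first.
  by apply: integral_ge0 => x _; rewrite lee_fin exprM exprn_ge0// sqr_ge0.
rewrite invf_div divfK ?gt_eqF// => H2; rewrite muleC; apply: H2.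
- by rewrite in_itv/= leey andbT integral_ge0// => x _; rewrite lee_fin sqr_ge0.
- by rewrite in_itv/= leey andbT mule_ge0 ?poweR_ge0.
Qed.
End moment_transfer.

(** * Consequences of moment bounds: L^p norms and almost sure bounds *)

Section moment_consequences.
Context {R : realType} {d : measure_display} {T : measurableType d}.
Variable P : probability T R.

(** If [b <= s] the first term suffices; otherwise [(b/s)^p <= (b/s)^n] because [b/s > 1] and
    [p <= n]. This passes from one integer moment to every real exponent below it. *)
Lemma powR_le_add_moment (b s p : R) (n : nat) : 0 <= b -> 0 < s -> 0 <= p <= n%:R ->
  b `^ p <= s `^ p + s `^ p * (s ^+ n)^-1 * b ^+ n.
Proof.
move=> b0 s0 /andP[p0 pn].
have [bs|sb] := leP b s.
  apply: (@le_trans _ _ (s `^ p)); first by rewrite ge0_ler_powR ?nnegrE// ltW.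
  by rewrite lerDl !mulr_ge0 ?powR_ge0 ?invr_ge0 ?exprn_ge0// ltW.
have b1 : 0 < b by exact: lt_trans sb.
apply: (@le_trans _ _ (s `^ p * (s ^+ n)^-1 * b ^+ n)); last by rewrite lerDr powR_ge0.
have sn : 0 < s ^+ n by rewrite exprn_gt0.
have split_pow x : 0 < x -> x ^+ n = x `^ p * x `^ (n%:R - p).
  move=> x0; have xn0 : (p + (n%:R - p) == 0) ==> (x != 0) by rewrite (gt_eqF x0) implybT.
  by rewrite -(powRD xn0) addrC subrK powR_mulrn// ltW.
rewrite mulrAC ler_pdivlMr// !split_pow// mulrCA.
rewrite ler_wpM2l ?powR_ge0// ler_wpM2l ?powR_ge0//.
by rewrite ge0_ler_powR ?nnegrE ?subr_ge0// ltW.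
Qed.

(** Integrating [powR_le_add_moment] against the probability [P] gives [s^p (1 + c)]. After the
    [p]-th root, [(1 + c)^(1/p) <= 1 + c] since [1 <= p]. *)
Lemma Lnorm_le_of_moment (N : T -> \bar R) (s c p : R) (n : nat) :
  measurable_fun setT N -> (forall w, 0 <= N w)%E -> 0 < s -> 0 <= c ->
  1 <= p <= n%:R ->
  (\int[P]_w (N w `^ n%:R) <= (c * s ^+ n)%:E)%E ->
  (Lnorm P p%:E N <= ((1 + c) * s)%:E)%E.
Proof.
move=> mN N0 s0 c0 /andP[p1 pn] mom.
have p0 : 0 < p by exact: lt_le_trans p1.
have sn : 0 < s ^+ n by rewrite exprn_gt0.
have n0 : n%:R != 0 :> R by rewrite gt_eqF// (lt_le_trans p0).
pose K : R := s `^ p * (s ^+ n)^-1.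
have K0 : 0 <= K by rewrite mulr_ge0 ?powR_ge0 ?invr_ge0// ltW.
have pointwise w : (`|N w| `^ p <= (s `^ p)%:E + K%:E * N w `^ n%:R)%E.
  rewrite gee0_abs//; have := N0 w; case: (N w) => [b| |//].
    rewrite lee_fin => b0; rewrite !poweR_EFin lee_fin powR_mulrn//.
    by apply: powR_le_add_moment => //; rewrite (ltW p0).
  (* Where [N w] is infinite, the right-hand side is infinite too because [K] is positive. *)
  move=> _; rewrite !poweRyr ?(gt_eqF p0)// gt0_muley ?lte_fin ?addey ?leey//.
  by rewrite mulr_gt0 ?invr_gt0// powR_gt0.
have mNn : measurable_fun setT (fun w => N w `^ n%:R)%E.
  exact: (measurableT_comp (measurable_poweR _)).
have int_le : (\int[P]_w (`|N w| `^ p) <= (s `^ p * (1 + c))%:E)%E.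
  apply: (@le_trans _ _ (\int[P]_w ((s `^ p)%:E + K%:E * N w `^ n%:R))%E).
    apply: ge0_le_integral => //.
    - by move=> w _; exact: poweR_ge0.
    - by apply: (measurableT_comp (measurable_poweR _)); exact: measurableT_comp.
    - by apply: emeasurable_funD => //; exact: emeasurable_funM.
  rewrite ge0_integralD//; last 3 first.
    - by move=> w _; rewrite lee_fin powR_ge0.
    - by move=> w _; rewrite mule_ge0 ?poweR_ge0.
    - exact: emeasurable_funM.
  rewrite integral_cst// [X in ((_ * X)%E + _)%E](_ : _ = 1%E); last exact: probability_setT.
  rewrite mule1 ge0_integralZl//; last first.
    by move=> w _; exact: poweR_ge0.
  rewrite mulrDr mulr1 EFinD leeD2l//.
  apply: (@le_trans _ _ (K%:E * (c * s ^+ n)%:E)%E); first by rewrite lee_wpmul2l.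
  by rewrite lee_fin /K [X in X <= _](_ : _ = s `^ p * c)//; field; rewrite gt_eqF.
rewrite unlock.
apply: (@le_trans _ _ ((s `^ p * (1 + c))%:E `^ p^-1)%E).
  apply: gt0_ler_poweR; rewrite ?invr_ge0 ?(ltW p0)//.
  - by rewrite in_itv/= leey andbT integral_ge0// => w _; exact: poweR_ge0.
  - by rewrite in_itv/= leey andbT lee_fin mulr_ge0 ?powR_ge0// addr_ge0.
rewrite poweR_EFin lee_fin powRM ?powR_ge0 ?addr_ge0// -powRrM divff ?gt_eqF//.
rewrite powRr1 ?(ltW s0)// mulrC ler_wpM2r ?(ltW s0)//.
rewrite -[leRHS]powRr1 ?addr_ge0// ler_powR ?lerDl//.
by rewrite invf_le1.
Qed.

(** The minimum equals [n] exactly on [A n] minus the earlier [A m], so every preimage is a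
    countable union of measurable sets. This makes the random index [kappa0] measurable. *)
Lemma measurable_ex_minn (A : nat -> set T) (exA : forall w, exists n, `[< A n w >]) :
  (forall n, measurable (A n)) -> measurable_fun setT (fun w => ex_minn (exA w)).
Proof.
move=> mA _ Y _; rewrite setTI.
rewrite (_ : _ @^-1` Y = \bigcup_(n in Y) (A n `\` \bigcup_(m in `I_n) A m)).
  apply: bigcup_measurable => n _; apply: measurableD => //.
  exact: bigcup_measurable.
apply/seteqP; split => [w /= Yw|w /= [n Yn [An nA]]].
  move: Yw; case: ex_minnP => n /asboolP An minA Yn; exists n => //; split => //.
  by move=> [m /= mn /asboolP/minA]; rewrite leqNgt mn.
case: ex_minnP => m /asboolP Am minA; suff -> : m = n by [].
apply/eqP; rewrite eqn_leq minA; last exact/asboolP.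
by rewrite leqNgt; apply/negP => mn; apply: nA; exists m.
Qed.

(** Chebyshev's inequality bounds the probability of [N k > x k] by [c k], and Borel-Cantelli
    applies since the [c k] are summable. The index [kappa0] is the least one beyond which no
    violation occurs. *)
Lemma ae_eventually_le (N : nat -> T -> \bar R) (x c : nat -> R) (n k0 : nat) :
  (forall k, measurable_fun setT (N k)) -> (forall k w, 0 <= N k w)%E ->
  (forall k, (k0 <= k)%N -> 0 < x k) ->
  (\sum_(k <oo) (c k)%:E < +oo)%E -> (forall k, 0 <= c k) ->
  (forall k, (k0 <= k)%N -> \int[P]_w (N k w `^ n%:R) <= (c k * x k ^+ n)%:E)%E ->
  exists kappa0 : T -> nat, measurable_fun setT kappa0 /\
    {ae P, forall w, forall k, (kappa0 w < k)%N -> (N k w <= (x k)%:E)%E}.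
Proof.
move=> mN N0 x0 csum c0 mom.
(* The moment bound starts at [k0]; the events below it are made empty so that the estimate by [c k]
   holds for every [k]. *)
pose F k := if (k0 <= k)%N then [set w | ((x k)%:E < N k w)%E] else set0.
have mlt k : measurable [set w | ((x k)%:E < N k w)%E].
  by rewrite -[X in measurable X]setTI; apply: emeasurable_fun_o_infty.
have mF k : measurable (F k) by rewrite /F; case: ifP.
have PF k : (P (F k) <= (c k)%:E)%E.
  rewrite /F; case: ifPn => [kk|_]; last by rewrite measure0 lee_fin.
  have xn : 0 < x k ^+ n by rewrite exprn_gt0 ?x0.
  rewrite -(@lee_pmul2r _ (x k ^+ n)%:E) ?lte_fin// -EFinM.
  apply: le_trans (mom k kk).
  rewrite muleC -integral_cst//.
  apply: (@le_trans _ _ (\int[P]_(w in [set w | ((x k)%:E < N k w)%E]) (N k w `^ n%:R))%E);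
    last first.
    apply: ge0_subset_integral => //; last by move=> w _; exact: poweR_ge0.
    exact: (measurableT_comp (measurable_poweR _)).
  apply: ge0_le_integral => //.
  - by move=> w _; rewrite lee_fin ltW.
  - by apply: measurable_funTS; exact: (measurableT_comp (measurable_poweR _)).
  move=> w /= /ltW xN.
  have -> : (x k ^+ n)%:E = ((x k)%:E `^ n%:R)%E.
    by rewrite poweR_EFin powR_mulrn// ltW// x0.
  by apply: gt0_ler_poweR => //; rewrite in_itv/= leey andbT// lee_fin ltW// x0.
have lim0 : P (lim_sup_set F) = 0%E.
  apply: lim_sup_set_cvg0 => //; apply: le_lt_trans csum.
  by apply: lee_nneseries => // k *; exact: PF.
pose good m := [set w | forall k, (m < k)%N -> (N k w <= (x k)%:E)%E].
have mgood m : measurable (good m).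
  rewrite (_ : good m = \bigcap_(k in [set k | (m < k)%N]) ~` [set w | ((x k)%:E < N k w)%E]).
    by apply: bigcap_measurableType => k _; exact: measurableC.
  by apply/seteqP; split => w /= h k /h; rewrite /setC /= leNgt => /negP.
(* Adding the points that no [good n] contains gives every [w] a least index; at those points it is
   0. *)
pose A m := good m `|` ~` \bigcup_n good n.
have mA m : measurable (A m).
  by apply: measurableU => //; apply: measurableC; exact: bigcup_measurable.
have exA w : exists m, `[< A m w >].
  have [[m _ gm]|ng] := pselect ((\bigcup_n good n) w); [exists m|exists 0%N].
  - by apply/asboolP; left.
  - by apply/asboolP; right.
exists (fun w => ex_minn (exA w)); split; first exact: measurable_ex_minn.
exists (lim_sup_set F); split => //.
  apply: bigcap_measurableType => m _.
  by apply: bigcup_measurable => k _; exact: mF.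
move=> w /= bad; apply: contrapT => notlim; apply: bad.
have [m gm] : exists m, good m w.
  move: notlim => /existsNP[m /not_implyP[_ hm]].
  (* Beyond [m] no [F k] occurs, and beyond [k0] the set [F k] is the actual violation event. *)
  exists (maxn m k0) => k; rewrite gtn_max => /andP[mk kk]; rewrite leNgt.
  by apply/negP => xN; apply: hm; exists k; rewrite /= ?(ltnW mk)// /F (ltnW kk).
case: ex_minnP => m' /asboolP[|[]]; first by move=> gm' _; exact: gm'.
by exists m.
Qed.
End moment_consequences.

(** * The truncated field *)

Section spectrum_tail.
Context {R : realType}.

(** Writing [x - 1 = x (1 - 1/x)] reduces the claim to [1 + g/x <= (1 - 1/x)^(-g)], which follows
    from [1 + u <= exp u] and [ln (1 - 1/x) <= -1/x]. It is a telescoping form of the integral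
    comparison for power tails. *)
Lemma powR_tail_step (g x : R) : 0 < g -> 1 < x ->
  g * (x `^ (- g) / x) <= (x - 1) `^ (- g) - x `^ (- g).
Proof.
move=> g0 x1; have x0 : 0 < x by lra.
have xV : 0 < 1 - x^-1 by rewrite subr_gt0 invf_lt1.
have -> : x - 1 = x * (1 - x^-1) by rewrite mulrBr mulr1 divff// gt_eqF.
rewrite powRM ?(ltW x0) ?(ltW xV)// lerBrDr mulrCA -[X in _ + X]mulr1 -mulrDr.
rewrite ler_wpM2l ?powR_ge0// /powR (gt_eqF xV).
apply: le_trans (expR_ge1Dx _); rewrite addrC lerD2l mulNr -mulrN ler_wpM2l ?(ltW g0)//.
by rewrite lerNr; apply: le_ln1Dx; rewrite ltrN2 invf_lt1.
Qed.

(** As [2l + 1 <= 3l], each term is at most [3 C l^(-(alpha-2)-1)], and [powR_tail_step] with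
    [g = alpha - 2] dominates it by a difference of consecutive powers. *)
Lemma spectrum_tail (A : nat -> R) (C alpha : R) (kappa n : nat) :
  0 <= C -> 2 < alpha -> (0 < kappa)%N ->
  (forall l, (kappa < l)%N -> A l <= C * l%:R `^ (- alpha)) ->
  \sum_(l < (kappa + n).+1 | (kappa < l)%N) A l * (2 * l%:R + 1) <=
  3 * C / (alpha - 2) * kappa%:R `^ (- (alpha - 2)).
Proof.
move=> C0 a2 k0 Ale; have g0 : 0 < alpha - 2 by lra.
have c0 : 0 <= 3 * C / (alpha - 2) by rewrite divr_ge0 ?mulr_ge0// ltW.
(* The bound is strengthened by the subtracted end term, so that the induction on [n] telescopes. *)
apply: (@le_trans _ _ (3 * C / (alpha - 2) * (kappa%:R `^ (- (alpha - 2)) -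
    (kappa + n)%:R `^ (- (alpha - 2))))); last first.
  by rewrite ler_wpM2l// gerBl powR_ge0.
elim: n => [|n IH].
  rewrite addn0 subrr mulr0 big1// => -[l /= lk] kl; by rewrite ltnS leqNgt kl in lk.
rewrite addnS big_mkcond big_ord_recr -big_mkcond/= ltnS leq_addr.
set l := (kappa + n).+1.
have l1 : 1 < l%:R :> R by rewrite ltr1n ltnS addn_gt0 k0.
have lp : 0 < l%:R :> R by lra.
have := powR_tail_step _ _ g0 l1.
rewrite (_ : l%:R - 1 = (kappa + n)%:R); last by rewrite -natr1 addrK.
set u := _ `^ _ in IH *; set v := _ `^ _ in IH *; set w := _ `^ _ => step.
have Al : A l * (2 * l%:R + 1) <= 3 * C * (w / l%:R).
  have kl : (kappa < l)%N by rewrite ltnS leq_addr.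
  have e : l%:R `^ (- alpha) * l%:R = w / l%:R.
    rewrite -(powR_inv1 (ltW lp)) -[X in _ * X = _]powRr1 ?(ltW lp)//.
    by rewrite -!powRD ?(gt_eqF lp) ?implybT//; congr (_ `^ _); lra.
  apply: (@le_trans _ _ (C * l%:R `^ (- alpha) * (3 * l%:R))).
    apply: (@le_trans _ _ (C * l%:R `^ (- alpha) * (2 * l%:R + 1))).
      by rewrite ler_wpM2r ?Ale//; lra.
    by rewrite ler_wpM2l ?mulr_ge0 ?powR_ge0//; lra.
  by rewrite mulrACA mulrC [X in _ <= X]mulrC mulrCA -e; lra.
apply: le_trans (lerD IH Al) _.
have -> : 3 * C * (w / l%:R) = 3 * C / (alpha - 2) * ((alpha - 2) * (w / l%:R)).
  by field; rewrite !gt_eqF.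
have := ler_wpM2l c0 step; lra.
Qed.
End spectrum_tail.

Section truncation_error.
Context {R : realType} {d : measure_display} {Omega : measurableType d}.
Variables (P : probability Omega R) (H : R) (A : nat -> R).
Variable beta : nat -> int -> R -> Omega -> R.
Hypothesis H0 : 0 < H.
Hypothesis A0 : forall l, 0 <= A l.
Hypothesis fbm : indep_fbm_family P H beta.

(** Measurability is part of [centered_gaussian], here for a one-term combination with coefficient
    1. *)
Lemma measurable_beta l m t : (`|m| <= l)%N -> 0 <= t -> measurable_fun setT (beta l m t).
Proof.
move=> ml t0; have [GF _] := fbm.
have [mX _] := GF 1%N (fun=> (l, m, t)) (fun=> 1) (fun=> conj ml t0).
rewrite (_ : beta l m t = fun w => \sum_(k < 1) 1 * beta l m t w)//.
by apply/funext => w; rewrite big_ord1 mul1r.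
Qed.

(** Positivity of [H] enters through the convention that the power [0] to the [0] is 1. *)
Lemma fbm_covtt t : fbm_cov H t t = t `^ (2 * H).
Proof.
rewrite /fbm_cov subrr normr0 powR0 ?mulf_neq0// ?gt_eqF//.
lra.
Qed.

Lemma trunc_fieldB kappa n t w (y : @pt R) :
  trunc_field A beta (kappa + n) t w y - trunc_field A beta kappa t w y =
  \sum_(l < (kappa + n).+1 | (kappa < l)%N) \sum_(i < (2 * l).+1)
    Num.sqrt (A l) * beta l (i%:Z - l%:Z) t w * Ylm l (i%:Z - l%:Z) y.
Proof.
pose F l := \sum_(i < (2 * l).+1)
  Num.sqrt (A l) * beta l (i%:Z - l%:Z) t w * Ylm l (i%:Z - l%:Z) y.
rewrite /trunc_field -/(F _).
rewrite (@big_ord_widen _ _ _ kappa.+1 (kappa + n).+1 F) ?ltnS ?leq_addr//.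
rewrite [X in X - _](bigID (fun l : 'I_ _ => (l < kappa.+1)%N))/= addrAC subrr add0r.
by apply: eq_bigl => l; rewrite -leqNgt.
Qed.

(** The increment is a finite linear combination of the [beta l m t]. Distinct pairs [(l, m)] have
    covariance 0, so its variance is a sum of squares, and [sum_Ylm_sqr] removes the dependence on
    [y]. *)
Lemma trunc_field_moment (kappa n q : nat) (t : R) (y : @pt R) :
  0 <= t -> x1 y ^+ 2 + x2 y ^+ 2 + x3 y ^+ 2 = 1 ->
  (\int[P]_w ((trunc_field A beta (kappa + n) t w y -
               trunc_field A beta kappa t w y) ^+ (2 * q.+1))%:E =
  ((t `^ (2 * H) * (\sum_(l < (kappa + n).+1 | (kappa < l)%N)
      A l * (2 * l%:R + 1)) / (4 * pi)) ^+ q.+1)%:E *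
  \int[@normal_prob R 0 1]_x (x ^+ (2 * q.+1))%:E)%E.
Proof.
move=> t0 y1; have [GF _] := fbm.
set m := (kappa + n).+1.
(* The double sum is flattened over dependent pairs, then enumerated to fit [gaussian_family]. The
   levels up to [kappa] stay in the index set with coefficient 0. *)
pose J := {l : 'I_m & 'I_(2 * l).+1}.
pose idx (j : J) : nat * int * R := (val (tag j), (tagged j)%:Z - (tag j)%:Z, t).
pose c (j : J) : R := if (kappa < tag j)%N then
  Num.sqrt (A (tag j)) * Ylm (tag j) ((tagged j)%:Z - (tag j)%:Z) y else 0.
(* Different indices give different [(l, m)], which kills the off-diagonal covariances. *)
have idx_inj j j' : (idx j).1 = (idx j').1 -> j = j'.
  case: j => l i; case: j' => l' i' /= [/val_inj ll]; subst l' => ii.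
  by congr Tagged; apply: val_inj => /=; lia.
have valid j : (`|(idx j).1.2| <= (idx j).1.1)%N /\ 0 <= (idx j).2.
  by split => //=; case: j => l i /=; have := ltn_ord i; lia.
have sumJ w : trunc_field A beta (kappa + n) t w y - trunc_field A beta kappa t w y =
    \sum_(k < #|{: J}|) c (enum_val k) *
      beta (idx (enum_val k)).1.1 (idx (enum_val k)).1.2 (idx (enum_val k)).2 w.
  rewrite trunc_fieldB -(big_enum_val (fun j => c j * beta (idx j).1.1 (idx j).1.2 (idx j).2 w)).
  rewrite sig_big_dep/= big_mkcond/=; apply: eq_bigr => j _.
  by rewrite /c andbT; case: ifP => _; rewrite ?mul0r// mulrAC.
have -> : t `^ (2 * H) * (\sum_(l < m | (kappa < l)%N) A l * (2 * l%:R + 1)) / (4 * pi) =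
  \sum_(k < #|{: J}|) \sum_(j < #|{: J}|) c (enum_val k) * c (enum_val j) *
   (if (idx (enum_val k)).1 == (idx (enum_val j)).1 then
      fbm_cov H (idx (enum_val k)).2 (idx (enum_val j)).2 else 0).
  pose v j := c j ^+ 2 * t `^ (2 * H).
  transitivity (\sum_(k < #|{: J}|) v (enum_val k)); last first.
    apply: eq_bigr => k _; rewrite (bigD1 k)//= eqxx fbm_covtt -expr2 big1 ?addr0// => j jk.
    rewrite ifF ?mulr0//; apply/negbTE; apply: contra jk => /eqP/idx_inj/enum_val_inj.
    by move=> ->.
  rewrite -(big_enum_val v).
  transitivity (\sum_(j : J | (kappa < tag j)%N && true) v j); last first.
    rewrite big_mkcond/=; apply: eq_bigr => j _.
    by rewrite /v /c andbT; case: (kappa < tag j)%N => //; rewrite expr0n mul0r.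
  have vE (l : 'I_m) (i : 'I_(2 * l).+1) : (kappa < l)%N ->
      v (Tagged (fun l : 'I_m => 'I_(2 * l).+1) i) =
      A l * t `^ (2 * H) * Ylm l (i%:Z - l%:Z) y ^+ 2.
    by move=> kl; rewrite /v /c/= kl exprMn sqr_sqrtr// mulrAC.
  rewrite -(sig_big_dep (fun l : 'I_m => (kappa < l)%N) (fun _ => xpredT)
    (fun l i => v (Tagged (fun l : 'I_m => 'I_(2 * l).+1) i))).
  rewrite -mulrA mulr_suml mulr_sumr; apply: eq_bigr => l kl.
  under eq_bigr do rewrite vE//.
  by rewrite -mulr_sumr sum_Ylm_sqr//; ring.
under eq_integral do rewrite sumJ.
pose X (i : nat * int * R) := beta i.1.1 i.1.2 i.2.
apply: (gaussian_family_moment P _ _ X _ _ (fun k => idx (enum_val k))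
  (fun k => c (enum_val k)) _ _ GF) => //.
apply: sumr_ge0 => k _; rewrite (bigD1 k)//= eqxx fbm_covtt -expr2 big1 ?addr0.
  by rewrite mulr_ge0 ?sqr_ge0 ?powR_ge0.
move=> j jk; rewrite ifF ?mulr0//; apply/negbTE.
by apply: contra jk => /eqP/idx_inj/enum_val_inj ->.
Qed.
End truncation_error.

(** * The cone measure on the sphere *)

Section lebesgue3_measure.
Context {R : realType}.
Local Notation leb := (@lebesgue_measure R).

(* The integral in [sph_int] sees [pt] with the canonical measurable structure of [R],
   whereas the product measure lives on the convertible [measurableTypeR R]. *)
Local Notation mR := (measurableTypeR R).
Let prodR : {measure set ((mR * mR) * mR)%type -> \bar R} :=
  ((leb \x leb) \x leb)%E.

Let lebesgue3_0 : @lebesgue3 R set0 = 0%E.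
Proof. exact: (measure0 prodR). Qed.

Let lebesgue3_ge0 A : (0 <= @lebesgue3 R A)%E.
Proof. exact: (measure_ge0 prodR). Qed.

Let lebesgue3_sigma_additive : semi_sigma_additive (@lebesgue3 R).
Proof. exact: (@measure_semi_sigma_additive _ _ _ prodR). Qed.

HB.instance Definition _ := isMeasure.Build _ _ _ (@lebesgue3 R)
  lebesgue3_0 lebesgue3_ge0 lebesgue3_sigma_additive.

Lemma lebesgue3_cube (a b : R) : a <= b ->
  lebesgue3 ((`[a, b] `*` `[a, b]) `*` `[a, b]) = ((b - a) ^+ 3)%:E.
Proof.
move=> ab.
have lebE : leb `[a, b]%classic = (b - a)%:E.
  rewrite lebesgue_measure_itv/= lte_fin; case: ltgtP ab => // -> _.
  by rewrite subrr.
have mI : measurable (`[a, b]%classic : set mR) by exact: measurable_itv.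
have E2 := product_measure1E leb leb mI mI.
have E3 := product_measure1E (leb \x leb)%E leb (measurableX mI mI) mI.
rewrite exprSr expr2 !EFinM -lebE; apply: (etrans E3); congr (_ * _)%E.
exact: E2.
Qed.

(** Exhaustion by the cubes of side [2n]; Tonelli's theorem on the product with [P] relies on it. *)
Let lebesgue3_sigma_finite : sigma_finite setT (@lebesgue3 R).
Proof.
exists (fun n : nat => (`[- n%:R, n%:R] `*` `[- n%:R, n%:R]) `*` `[- n%:R, n%:R]).
  apply/esym/seteqP; split => // y _.
  pose M := `|y.1.1| + `|y.1.2| + `|y.2|.
  have le_abs (u : R) : `|u| <= M -> `[- (truncn M).+1%:R, (truncn M).+1%:R]%classic u.
    by move=> uM; rewrite /= in_itv/= -ler_norml (le_trans uM)// ltW// truncnS_gt.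
  exists (truncn M).+1 => //; split; [split|]; apply: le_abs; rewrite /M.
  - by rewrite -addrA lerDl addr_ge0.
  - by rewrite addrAC lerDr addr_ge0.
  - by rewrite lerDr addr_ge0.
move=> n; split; first by apply: measurableX => //; exact: measurableX.
by rewrite lebesgue3_cube ?ltry// lerNl -subr_ge0 opprK addr_ge0.
Qed.

HB.instance Definition _ := Measure_isSigmaFinite.Build _ _ _ (@lebesgue3 R)
  lebesgue3_sigma_finite.

Lemma measurable_x1 : measurable_fun setT (@x1 R).
Proof. exact: (measurableT_comp measurable_fst measurable_fst). Qed.

Lemma measurable_x2 : measurable_fun setT (@x2 R).
Proof. exact: (measurableT_comp measurable_snd measurable_fst). Qed.

Lemma measurable_x3 : measurable_fun setT (@x3 R).
Proof. exact: measurable_snd. Qed.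

Let sqr_norm (y : @pt R) := x1 y ^+ 2 + x2 y ^+ 2 + x3 y ^+ 2.

Let sqr_norm_ge0 y : 0 <= sqr_norm y.
Proof. by rewrite !addr_ge0 ?sqr_ge0. Qed.

Let measurable_sqr_norm : measurable_fun setT sqr_norm.
Proof.
by apply: measurable_funD; [apply: measurable_funD|]; apply: measurable_funX;
  [exact: measurable_x1|exact: measurable_x2|exact: measurable_x3].
Qed.

Lemma measurable_enorm : measurable_fun setT (@enorm R).
Proof.
rewrite (_ : @enorm R = (@powR R)^~ 2^-1 \o sqr_norm).
  exact: (measurableT_comp (measurable_powR _)).
by apply/funext => y; rewrite /= powR12_sqrt ?sqr_norm_ge0.
Qed.

Lemma measurable_normalize : measurable_fun setT (@normalize R).
Proof.
have inv : measurable_fun setT (fun y => (@enorm R y)^-1).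
  (* Writing the inverse as the power [-1] is also correct at the origin, where both conventions
     give 0. *)
  rewrite (_ : (fun y => _) = (@powR R)^~ (-1) \o @enorm R).
    by apply: (measurableT_comp (measurable_powR _)); exact: measurable_enorm.
  by apply/funext => y; rewrite /= powR_inv1// sqrtr_ge0.
apply: measurable_fun_pair; first apply: measurable_fun_pair.
- by apply: measurable_funM => //; exact: measurable_x1.
- by apply: measurable_funM => //; exact: measurable_x2.
- by apply: measurable_funM => //; exact: measurable_x3.
Qed.

Lemma measurable_pball : measurable (@pball R).
Proof.
rewrite (_ : pball = setT `&` @enorm R @^-1` `]0, 1]%classic).
  exact: measurable_enorm.
by rewrite setTI; apply/seteqP; split => y; rewrite /pball/= in_itv.
Qed.

Lemma normalize_sphere (y : @pt R) : pball y ->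
  x1 (normalize y) ^+ 2 + x2 (normalize y) ^+ 2 + x3 (normalize y) ^+ 2 = 1.
Proof.
move=> /andP[y0 _]; rewrite /normalize /x1 /x2 /x3/= !exprMn -!mulrDl exprVn.
have e : enorm y ^+ 2 = y.1.1 ^+ 2 + y.1.2 ^+ 2 + y.2 ^+ 2 by rewrite sqr_sqrtr ?sqr_norm_ge0.
by rewrite -e divff// expf_neq0// gt_eqF.
Qed.

(** The ball lies in the cube [[-1, 1]^3]. This crude volume bound affects only the constants. *)
Lemma lebesgue3_pball : (lebesgue3 (@pball R) <= 8%:E)%E.
Proof.
have -> : 8 = (1 - (-1)) ^+ 3 :> R by ring.
rewrite -lebesgue3_cube; last by lra.
apply: le_measure; rewrite ?inE; [exact: measurable_pball| |].
  by apply: measurableX => //; exact: measurableX.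
move=> y /andP[_ y1]; have y1' : sqr_norm y <= 1.
  by rewrite -(sqr_sqrtr (sqr_norm_ge0 y)) expr_le1// sqrtr_ge0.
have := sqr_ge0 (x1 y); have := sqr_ge0 (x2 y); have := sqr_ge0 (x3 y).
move: y1'; rewrite /sqr_norm /x1 /x2 /x3 => y1' h3 h2 h1.
have bd (u : R) : u ^+ 2 <= 1 -> u \in `[-1, 1]%classic.
  by move=> u1; rewrite inE/= in_itv/=; apply/andP; split; nra.
by split; [split|]; apply/set_mem/bd; lra.
Qed.

(** The restriction to the ball becomes an indicator in the integrand, so that the integral runs
    over the whole space and fits the product measure. *)
Lemma sph_norm2E (g : @pt R -> R) :
  sph_norm2 g = (3%:E * \int[@lebesgue3 R]_y ((g (normalize y) * \1_pball y) ^+ 2)%:E)%E.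
Proof.
rewrite /sph_norm2 /sph_int integral_mkcond; congr (_ * _)%E.
apply: eq_integral => y _; rewrite patchE indicE.
by case: ifP => _; rewrite ?mulr1// mulr0 expr0n.
Qed.

Lemma measurable_horner (p : {poly R}) : measurable_fun setT (horner p).
Proof.
rewrite (_ : horner p = fun x => \sum_(i < size p) p`_i * x ^+ i).
  by apply: measurable_sum => i; apply: measurable_funM => //; exact: measurable_funX.
by apply/funext => x; rewrite horner_coef.
Qed.

Lemma measurable_cssn m : measurable_fun setT (fun y : @pt R => (cssn m y).1) /\
  measurable_fun setT (fun y : @pt R => (cssn m y).2).
Proof.
elim: m => [|m [mc ms]] //=.
have E (y : @pt R) : (let '(c, s) := cssn m y in
      (x1 y * c - x2 y * s, x1 y * s + x2 y * c)) =
    (x1 y * (cssn m y).1 - x2 y * (cssn m y).2,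
     x1 y * (cssn m y).2 + x2 y * (cssn m y).1) by case: cssn.
split; under eq_fun do rewrite E/=.
  by apply: measurable_funB; apply: measurable_funM => //;
    [exact: measurable_x1|exact: measurable_x2].
by apply: measurable_funD; apply: measurable_funM => //;
  [exact: measurable_x1|exact: measurable_x2].
Qed.

Lemma measurable_Ylm l m : measurable_fun setT (@Ylm R l m).
Proof.
have mP k : measurable_fun setT (fun y : @pt R => (legendre_deriv l k).[x3 y]).
  by apply: (measurableT_comp (measurable_horner _)); exact: measurable_x3.
case: m => [[|k]|k] /=.
- exact: measurable_funM.
- apply: measurable_funM; last exact: (measurable_cssn k.+1).1.
  by apply: measurable_funM.
- apply: measurable_funM; last exact: (measurable_cssn k.+1).2.
  by apply: measurable_funM.
Qed.
End lebesgue3_measure.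

(** * The truncation error *)

Section error_moment.
Context {R : realType} {d : measure_display} {Omega : measurableType d}.
Variables (P : probability Omega R) (H T C alpha : R) (A : nat -> R) (l0 : nat).
Variables (beta : nat -> int -> R -> Omega -> R) (B : R -> Omega -> @pt R -> R).
Hypothesis H01 : 0 < H < 1.
Hypothesis T0 : 0 < T.
Hypothesis C0 : 0 < C.
Hypothesis alpha2 : 2 < alpha.
Hypothesis A0 : forall l, 0 <= A l.
Hypothesis l01 : (1 <= l0)%N.
Hypothesis Ale : forall l : nat, (l0 < l)%N -> A l <= C * l%:R `^ (- alpha).
Hypothesis fbm : indep_fbm_family P H beta.
Variable t : R.
Hypothesis t0T : 0 <= t <= T.
Hypothesis mB : measurable_fun setT (fun q : Omega * @pt R => B t q.1 q.2).
Hypothesis Bcvg : (fun kappa : nat => (\int[P]_w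
    sph_norm2 (fun y => (B t w y - trunc_field A beta kappa t w y)%R))%E) @ \oo --> 0%E.

(** The truncation error pulled back to the ball by [normalize]; the integral of its square over the
    product is one third of the expected [sph_norm2]. *)
Let error kappa (u : Omega * @pt R) :=
  (B t u.1 (normalize u.2) - trunc_field A beta kappa t u.1 (normalize u.2)) * \1_pball u.2.

Let increment kappa n (u : Omega * @pt R) :=
  (trunc_field A beta (kappa + n) t u.1 (normalize u.2) -
   trunc_field A beta kappa t u.1 (normalize u.2)) * \1_pball u.2.

Let measurable_indic_pball :
  measurable_fun setT (fun u : Omega * @pt R => \1_pball u.2 : R).
Proof.
apply: (measurableT_comp _ measurable_snd).
by apply: measurable_indic; exact: measurable_pball.
Qed.

Let measurable_trunc kappa : measurable_fun setT
  (fun u : Omega * @pt R => trunc_field A beta kappa t u.1 (normalize u.2)).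
Proof.
have t0 : 0 <= t by case/andP: t0T.
rewrite /trunc_field; apply: measurable_sum => l; apply: measurable_sum => i.
apply: measurable_funM; first apply: measurable_funM => //.
  apply: (measurableT_comp _ measurable_fst); apply: (measurable_beta P H beta fbm) => //.
  by have := ltn_ord i; lia.
apply: (measurableT_comp (measurable_Ylm _ _)).
exact: (measurableT_comp measurable_normalize measurable_snd).
Qed.

Let measurable_error kappa : measurable_fun setT (error kappa).
Proof.
apply: measurable_funM => //; apply: measurable_funB => //.
have mg : measurable_fun setT (fun q : Omega * @pt R => (q.1, normalize q.2)).
  apply: measurable_fun_pair; first exact: measurable_fst.
  exact: (measurableT_comp measurable_normalize measurable_snd).
exact: (measurableT_comp mB mg).
Qed.

Let measurable_increment kappa n : measurable_fun setT (increment kappa n).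
Proof. by apply: measurable_funM => //; exact: measurable_funB. Qed.

Let sqr_error_ge0 kappa u : (0 <= (error kappa u ^+ 2)%:E)%E.
Proof. by rewrite lee_fin sqr_ge0. Qed.

Let measurable_sqr_error kappa :
  measurable_fun setT (fun u => (error kappa u ^+ 2)%:E).
Proof. by apply/measurable_EFinP; exact: measurable_funX. Qed.

Definition error_norm kappa w :=
  sph_norm (fun y => (B t w y - trunc_field A beta kappa t w y)%R).

Lemma measurable_error_norm kappa : measurable_fun setT (error_norm kappa).
Proof.
rewrite /error_norm /sph_norm; apply: (measurableT_comp (measurable_poweR _)).
under eq_fun do rewrite sph_norm2E.
apply: emeasurable_funM => //.
exact: (measurable_fun_fubini_tonelli_F (m2 := @lebesgue3 R) _
  (measurable_sqr_error kappa) (sqr_error_ge0 kappa)).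
Qed.

Lemma error_norm_ge0 kappa w : (0 <= error_norm kappa w)%E.
Proof. exact: poweR_ge0. Qed.

(** The constant of [spectrum_tail] divided by the [4 pi] of [sum_Ylm_sqr]. *)
Definition variance_const : R := 3 * C / (alpha - 2) / (4 * pi).

(** The square root of the variance bound [variance_const T^(2H) kappa^(-(alpha-2))] for the
    increments. *)
Definition error_scale kappa : R :=
  Num.sqrt variance_const * T `^ H * kappa%:R `^ (- ((alpha - 2) / 2)).

Let variance_const_gt0 : 0 < variance_const.
Proof. by rewrite !divr_gt0 ?mulr_gt0 ?pi_gt0 ?subr_gt0. Qed.

Lemma error_scale_gt0 kappa : (0 < kappa)%N -> 0 < error_scale kappa.
Proof. by move=> k0; rewrite !mulr_gt0 ?sqrtr_gt0 ?powR_gt0 ?ltr0n. Qed.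

Lemma error_scale_sqr kappa : error_scale kappa ^+ 2 =
  variance_const * T `^ (2 * H) * kappa%:R `^ (- (alpha - 2)).
Proof.
rewrite !exprMn sqr_sqrtr ?ltW// -!powR_mulrn ?powR_ge0// -!powRrM.
by congr (_ * _ `^ _ * _ `^ _); [rewrite mulrC|field].
Qed.

Definition gauss_const q : R :=
  fine (\int[@normal_prob R 0 1]_x (x ^+ (2 * q))%:E).

(** Tonelli's theorem puts the integral over [Omega] inside: at fixed [y] the increment is Gaussian
    with variance at most [error_scale kappa ^+ 2]. The outer integral then costs only the volume of
    the ball. *)
Let increment_moment kappa n q : (l0 <= kappa)%N ->
  (\int[(P \x @lebesgue3 R)]_u (increment kappa n u ^+ (2 * q.+1))%:E <=
   (error_scale kappa ^+ (2 * q.+1) * gauss_const q.+1 * 8)%:E)%E.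
Proof.
move=> kl0; have k0 : (0 < kappa)%N by exact: leq_trans kl0.
have t0 : 0 <= t by case/andP: t0T.
set K := error_scale kappa ^+ (2 * q.+1) * gauss_const q.+1.
have m0 : (0 <= \int[@normal_prob R 0 1]_x (x ^+ (2 * q.+1))%:E)%E.
  by apply: integral_ge0 => x _; rewrite lee_fin exprM exprn_ge0 ?sqr_ge0.
have g0 : 0 <= gauss_const q.+1 by apply: fine_ge0.
have gE : (\int[@normal_prob R 0 1]_x (x ^+ (2 * q.+1))%:E = (gauss_const q.+1)%:E)%E.
  by rewrite /gauss_const fineK// ge0_fin_numE// normal_moment_lty.
have K0 : 0 <= K.
  by rewrite mulr_ge0// exprn_ge0// ltW// error_scale_gt0.
have mi : measurable_fun setT (fun u => (increment kappa n u ^+ (2 * q.+1))%:E).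
  by apply/measurable_EFinP; exact: measurable_funX.
have i0 u : (0 <= (increment kappa n u ^+ (2 * q.+1))%:E)%E.
  by rewrite lee_fin exprM exprn_ge0 ?sqr_ge0.
rewrite fubini_tonelli2//.
apply: (@le_trans _ _ (\int[@lebesgue3 R]_y (K * \1_pball y)%:E)%E).
  apply: ge0_le_integral => //.
  - by move=> y _; apply: integral_ge0.
  - exact: (measurable_fun_fubini_tonelli_G (m1 := P) _ mi i0).
  - apply/measurable_EFinP; apply: measurable_funM => //.
    by apply: measurable_indic; exact: measurable_pball.
  move=> y _; rewrite /fubini_G /increment /= indicE.
  have [yD|yD] := boolP (y \in pball); last first.
    by rewrite mulr0; under eq_integral do rewrite mulr0 expr0n; rewrite integral0.
  under eq_integral do rewrite mulr1.
  rewrite mulr1 (trunc_field_moment P H A beta)//; first last.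
  - by apply: normalize_sphere; exact/set_mem.
  - by case/andP: H01.
  rewrite gE -EFinM lee_fin ler_wpM2r// exprM; apply: ler_expn.
    rewrite divr_ge0 ?mulr_ge0 ?powR_ge0 ?pi_ge0//; apply: sumr_ge0 => l _.
    by rewrite mulr_ge0// addr_ge0// mulr_ge0.
  rewrite error_scale_sqr /variance_const.
  have tT : t `^ (2 * H) <= T `^ (2 * H).
    case/andP: t0T => _ tT; case/andP: H01 => H0 _.
    by rewrite ge0_ler_powR ?nnegrE ?mulr_ge0// ltW.
  have := spectrum_tail A C alpha kappa n (ltW C0) alpha2 k0.
  move=> /(_ (fun l kl => Ale l (leq_ltn_trans kl0 kl))) tail.
  rewrite [leRHS](_ : _ = T `^ (2 * H) *
    (3 * C / (alpha - 2) * kappa%:R `^ (- (alpha - 2))) / (4 * pi)); last by ring.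
  rewrite ler_wpM2r ?invr_ge0 ?mulr_ge0 ?pi_ge0// ler_pM ?powR_ge0//.
  by apply: sumr_ge0 => l _; rewrite mulr_ge0// addr_ge0// mulr_ge0.
under eq_integral do rewrite EFinM.
rewrite ge0_integralZl//; last first.
  by apply/measurable_EFinP; apply: measurable_indic; exact: measurable_pball.
rewrite integral_indic//; last exact: measurable_pball.
clearbody K; rewrite setIT EFinM; apply: lee_wpmul2l; first by rewrite lee_fin.
exact: lebesgue3_pball.
Qed.

(** Subtracting the increment from the error leaves the error at level [n + kappa], so this is the
    assumed convergence shifted by [kappa], up to the factor 3 of the cone measure. *)
Let error_cvg kappa : (fun n => \int[(P \x @lebesgue3 R)]_u
    ((error kappa u - increment kappa n u) ^+ 2)%:E)%E @ \oo --> 0%E.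
Proof.
have E n : (\int[(P \x @lebesgue3 R)]_u ((error kappa u - increment kappa n u) ^+ 2)%:E =
    (3^-1)%:E * \int[P]_w
      sph_norm2 (fun y => (B t w y - trunc_field A beta (n + kappa) t w y)%R))%E.
  under eq_integral.
    move=> u _; rewrite (_ : error kappa u - increment kappa n u = error (n + kappa) u).
      over.
    by rewrite /error /increment -mulrBl addnC; congr (_ * _); ring.
  rewrite fubini_tonelli1//.
  under [in RHS]eq_integral do rewrite sph_norm2E.
  rewrite ge0_integralZl//; last 2 first.
  - exact: (measurable_fun_fubini_tonelli_F (m2 := @lebesgue3 R)
      _ (measurable_sqr_error (n + kappa)) (sqr_error_ge0 (n + kappa))).
  - by move=> w _; apply: integral_ge0 => y _; rewrite lee_fin sqr_ge0.
  by rewrite muleA -EFinM mulVf// mul1e.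
under eq_fun do rewrite E.
rewrite -(mule0 (3^-1)%:E); apply: cvgeZl => //.
by move: Bcvg; rewrite -(cvg_shiftn kappa).
Qed.

(* [3 ^+ q.+2] normalises the cone measure, [8] bounds the volume of the ball (in Hoelder's
   inequality and in the integral over [y]), and [4 ^+ q.+2] is lost in
   [moment_transfer]. *)
Definition error_const q : R :=
  3 ^+ q.+2 * 8 ^+ q.+1 * 4 ^+ q.+2 * (gauss_const q.+2 * 8).

Lemma error_const_ge0 q : 0 <= error_const q.
Proof.
have g0 : 0 <= gauss_const q.+2.
  apply: fine_ge0; apply: integral_ge0 => x _.
  by rewrite lee_fin exprM exprn_ge0 ?sqr_ge0.
by rewrite /error_const; apply: mulr_ge0; rewrite mulr_ge0// ?mulr_ge0 ?exprn_ge0.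
Qed.

(** For each [w], Hoelder's inequality on the ball bounds the power of the norm by an integral of
    [error ^+ (2 * q.+2)]. Integrating over [Omega] leaves a moment on the product, which
    [moment_transfer] controls by those of the increments. *)
Lemma error_norm_moment kappa q : (l0 <= kappa)%N ->
  (\int[P]_w (error_norm kappa w `^ (2 * q.+2)%:R) <=
   (error_const q * error_scale kappa ^+ (2 * q.+2))%:E)%E.
Proof.
move=> kl0.
have transfer := moment_transfer (P \x @lebesgue3 R)%E (error kappa) (increment kappa)
  q.+1 _ (measurable_error kappa) (measurable_increment kappa)
  (fun n => increment_moment kappa n q.+1 kl0) (error_cvg kappa).
have me : measurable_fun setT (fun u => (error kappa u ^+ (2 * q.+2))%:E).
  by apply/measurable_EFinP; exact: measurable_funX.
have e0 u : (0 <= (error kappa u ^+ (2 * q.+2))%:E)%E.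
  by rewrite lee_fin exprM exprn_ge0 ?sqr_ge0.
rewrite fubini_tonelli1// in transfer.
have mF := measurable_fun_fubini_tonelli_F (m2 := @lebesgue3 R) _ me e0.
have pointwise w : (error_norm kappa w `^ (2 * q.+2)%:R <= (3 ^+ q.+2 * 8 ^+ q.+1)%:E *
    \int[@lebesgue3 R]_y (error kappa (w, y) ^+ (2 * q.+2))%:E)%E.
  rewrite /error_norm /sph_norm -poweRrM natrM mulrA mulVf// mul1r sph_norm2E.
  rewrite poweRM//; last by apply: integral_ge0 => y _; rewrite lee_fin sqr_ge0.
  rewrite poweR_EFin powR_mulrn// EFinM -muleA lee_wpmul2l ?lee_fin ?exprn_ge0//.
  have mew : measurable_fun setT (fun y => error kappa (w, y)).
    exact: (measurableT_comp (measurable_error kappa) (measurable_pair1 w)).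
  have := pow_integral_sqr_le (@lebesgue3 R) pball (fun y => error kappa (w, y)) q
    measurable_pball mew.
  rewrite {1}/error/= => /(_ _)/le_trans; apply.
    by move=> y yD; rewrite indicE memNset// mulr0.
  apply: lee_wpmul2r; first by apply: integral_ge0.
  apply: (@le_trans _ _ (8%:E `^ q.+1%:R)%E); last by rewrite poweR_EFin powR_mulrn.
  apply: gt0_ler_poweR; rewrite ?ler0n ?in_itv/= ?leey ?andbT ?lee_fin//.
  exact: lebesgue3_pball.
apply: (@le_trans _ _ (\int[P]_w ((3 ^+ q.+2 * 8 ^+ q.+1)%:E *
    \int[@lebesgue3 R]_y (error kappa (w, y) ^+ (2 * q.+2))%:E))%E).
  apply: ge0_le_integral => //.
  - by move=> w _; exact: poweR_ge0.
  - by apply: (measurableT_comp (measurable_poweR _)); exact: measurable_error_norm.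
  - exact: emeasurable_funM.
rewrite ge0_integralZl//; last by move=> w _; apply: integral_ge0.
apply: (le_trans (lee_wpmul2l _ transfer)); first by rewrite lee_fin mulr_ge0 ?exprn_ge0.
by rewrite -!EFinM lee_fin /error_const le_eqVlt; apply/orP; left; apply/eqP; ring.
Qed.

End error_moment.

(** * Elementary limits and series, and the conclusion *)

Lemma powRN_small (R : realType) (M g eps : R) : 0 < g -> 0 <= M -> 0 < eps ->
  (* The threshold solves [k^g >= c]; the added 1 keeps [c] positive when [M = 0]. *)
  exists K : nat, forall k : nat, (K <= k)%N -> M * k%:R `^ (- g) <= eps.
Proof.
move=> g0 M0 e0; pose c := M / eps + 1.
have c0 : 0 < c by rewrite ltr_wpDl// divr_ge0// ltW.
exists (truncn (c `^ g^-1)).+1 => k Kk.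
have ck : c `^ g^-1 < k%:R by apply: lt_le_trans (truncnS_gt _) _; rewrite ler_nat.
have k0 : 0 < k%:R :> R by apply: le_lt_trans ck; exact: powR_ge0.
have ckg : c <= k%:R `^ g.
  have -> : c = (c `^ g^-1) `^ g by rewrite -powRrM mulVf ?gt_eqF// powRr1// ltW.
  by rewrite ge0_ler_powR ?nnegrE ?powR_ge0// ltW.
rewrite powRN ler_pdivrMr ?powR_gt0//.
apply: (@le_trans _ _ (eps * c)); last by rewrite ler_wpM2l// ltW.
by rewrite /c mulrDr mulrCA divff ?gt_eqF// !mulr1 lerDl ltW.
Qed.

(** The partial sums telescope through [1/(x+1)^2 <= 1/x - 1/(x+1)]. The term [k = 0] vanishes, as
    the inverse of 0 is 0. *)
Lemma sum_inv_sqr_lty (R : realType) (c : R) : 0 <= c ->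
  (\sum_(k <oo) (c / k%:R ^+ 2)%:E < +oo)%E.
Proof.
move=> c0.
have term0 k : 0 <= c / k%:R ^+ 2 by rewrite divr_ge0 ?exprn_ge0.
have partial n : \sum_(0 <= k < n.+2) c / k%:R ^+ 2 <= c * (2 - n.+1%:R^-1).
  elim: n => [|n IH].
    by rewrite big_nat_recr//= big_nat1 expr0n invr0 mulr0 add0r expr1n; lra.
  rewrite big_nat_recr//=; apply: le_trans (lerD IH (lexx _)) _.
  rewrite -mulrDr ler_wpM2l//.
  have n1 : 0 < n.+1%:R :> R by rewrite ltr0n.
  rewrite -[n.+2%:R]natr1; set x := n.+1%:R in n1 *.
  rewrite -subr_ge0 [leRHS](_ : _ = (x * (x + 1) ^+ 2)^-1).
    by rewrite invr_ge0 mulr_ge0 ?exprn_ge0//; lra.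
  by field; apply/andP; split; rewrite gt_eqF//; lra.
apply: (@le_lt_trans _ _ (c * 2)%:E); last exact: ltry.
apply: lime_le; first by apply: is_cvg_nneseries => k _ _; rewrite lee_fin.
apply: nearW => n; rewrite sumEFin lee_fin.
apply: (@le_trans _ _ (\sum_(0 <= k < n.+2) c / k%:R ^+ 2)).
  by rewrite !big_nat_recr//= -addrA lerDl addr_ge0.
apply: (le_trans (partial n)).
by rewrite ler_wpM2l// gerBl invr_ge0.
Qed.

Theorem theorem5p1 (R : realType) (p C alpha : R) :
  1 <= p -> 0 < C -> 2 < alpha ->
  exists Chat : R,
  forall (H T : R) (A : nat -> R) (l0 : nat)
    (d : measure_display) (Omega : measurableType d) (P : probability Omega R)
    (beta : nat -> int -> R -> Omega -> R) (B : R -> Omega -> @pt R -> R),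
  0 < H < 1 -> 0 < T ->
  (forall l, 0 <= A l) ->
  (1 <= l0)%N ->
  (forall l : nat, (l0 < l)%N -> A l <= C * l%:R `^ (- alpha)) ->
  indep_fbm_family P H beta ->
  (* B_Q^H(t) is the L^2(Omega; L^2(S^2))-limit of the series *)
  (forall t, 0 <= t <= T ->
     measurable_fun setT (fun q : Omega * @pt R => B t q.1 q.2) /\
     ((fun kappa : nat =>
        (\int[P]_w sph_norm2 (fun y => (B t w y - trunc_field A beta kappa t w y)%R))%E)
        @ \oo --> 0%E)) ->
  (* convergence in L^p(Omega; L^2(S^2)), uniformly on [0, T], with rate *)
  (forall kappa : nat, (l0 <= kappa)%N -> forall t, 0 <= t <= T ->
     (Lnorm P p%:E (fun w => sph_norm (fun y => (B t w y - trunc_field A beta kappa t w y)%R))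
       <= (Chat * T `^ H * kappa%:R `^ (- ((alpha - 2) / 2)))%:E)%E) /\
  (forall eps : R, 0 < eps -> exists K : nat, forall kappa : nat, (K <= kappa)%N ->
     forall t, 0 <= t <= T ->
     (Lnorm P p%:E (fun w => sph_norm (fun y => (B t w y - trunc_field A beta kappa t w y)%R))
       <= eps%:E)%E) /\
  (* almost sure convergence with rate kappa^(-b) *)
  (forall t, 0 <= t <= T -> forall b : R, b < (alpha - 2) / 2 ->
     exists kappa0 : Omega -> nat, measurable_fun setT kappa0 /\
     {ae P, forall w, forall kappa : nat, (kappa0 w < kappa)%N ->
        (sph_norm (fun y => (B t w y - trunc_field A beta kappa t w y)%R)
          <= (kappa%:R `^ (- b))%:E)%E}).
Proof.
(* With this [q], [p < q + 1 <= 2 (q + 2)], so the moment of order [2 (q + 2)] controls the [L^p]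
   norm. The constant is fixed before [H], [T], [A] and [l0] are introduced. *)
move=> p1 C0 alpha2; pose q := truncn p.
have c0 := @error_const_ge0 R.
exists ((1 + error_const q) * Num.sqrt (variance_const C alpha)).
move=> H T A l0 d Omega P beta B H01 T0 A0 l01 Ale fbm lim.
have g0 : 0 < (alpha - 2) / 2 by rewrite divr_gt0 ?subr_gt0.
have rate (kappa : nat) : (l0 <= kappa)%N -> forall t, 0 <= t <= T ->
    (Lnorm P p%:E (fun w => sph_norm (fun y => (B t w y - trunc_field A beta kappa t w y)%R))
      <= ((1 + error_const q) * Num.sqrt (variance_const C alpha) * T `^ H *
          kappa%:R `^ (- ((alpha - 2) / 2)))%:E)%E.
  move=> kl0 t tT; have [mB cB] := lim t tT.
  rewrite (_ : _ * _ * _ * _ = (1 + error_const q) * error_scale H T C alpha kappa); last first.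
    by rewrite /error_scale !mulrA.
  apply: (Lnorm_le_of_moment P (error_norm A beta B t kappa) _ _ _ (2 * q.+2)%N) => //.
  - exact: (measurable_error_norm P H T C alpha A l0).
  - by move=> w; exact: error_norm_ge0.
  - by apply: error_scale_gt0 => //; exact: leq_trans kl0.
  - rewrite p1/=; apply/ltW/(lt_le_trans (truncnS_gt _)); rewrite ler_nat -/q.
    by rewrite mul2n -addnn; lia.
  - exact: (error_norm_moment P H T C alpha A l0).
split; first exact: rate.
split.
  move=> eps e0.
  have M0 : 0 <= (1 + error_const q) * Num.sqrt (variance_const C alpha) * T `^ H :> R.
    by rewrite !mulr_ge0 ?sqrtr_ge0 ?powR_ge0// addr_ge0.
  have [K HK] := powRN_small _ _ _ _ g0 M0 e0.
  exists (maxn K l0) => kappa; rewrite geq_max => /andP[Kk kl0] t tT.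
  by apply: le_trans (rate _ kl0 _ tT) _; rewrite lee_fin HK.
move=> t tT b bg; have [mB cB] := lim t tT.
have bg0 : 0 < alpha - 2 - 2 * b by lra.
(* Chosen so that [(alpha - 2 - 2b)(r + 2) >= 2]: the moment of order [2 (r + 2)] divided by that
   power of [k^(-b)] is then at most [S / k^2], which is summable. *)
pose r := truncn (2 / (alpha - 2 - 2 * b)).
pose S := error_const r * (Num.sqrt (variance_const C alpha) * T `^ H) ^+ (2 * r.+2).
have S0 : 0 <= S.
  by rewrite mulr_ge0// exprn_ge0// mulr_ge0 ?sqrtr_ge0 ?powR_ge0.
apply: (ae_eventually_le P (error_norm A beta B t) (fun k => k%:R `^ (- b))
  (fun k => S / k%:R ^+ 2) (2 * r.+2)%N l0).
- move=> k; exact: (measurable_error_norm P H T C alpha A l0).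
- by move=> k w; exact: error_norm_ge0.
- by move=> k kl0; rewrite powR_gt0// ltr0n (leq_trans l01).
- exact: sum_inv_sqr_lty.
- by move=> k; rewrite divr_ge0 ?exprn_ge0.
move=> k kl0.
apply: le_trans
  (error_norm_moment P H T C alpha A l0 _ _ _ _ _ _ _ _ _ _ _ tT mB cB k r kl0) _ => //.
rewrite lee_fin /error_scale exprMn mulrA -/S -mulrA ler_wpM2l//.
have k1 : 1 <= k%:R :> R by rewrite ler1n (leq_trans l01).
have k0 : 0 < k%:R :> R by exact: lt_le_trans k1.
rewrite -!powR_mulrn ?powR_ge0// -!powRrM -(powRN _ 2%:R).
rewrite -powRD ?(gt_eqF k0) ?implybT//; apply: ler_powR => //.
have : 2 <= (alpha - 2 - 2 * b) * r.+2%:R.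
  rewrite mulrC -ler_pdivrMr//; apply/ltW/(lt_le_trans (truncnS_gt _)).
  by rewrite ler_nat -/r.
by rewrite natrM; lra.
Qed.
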